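(* Let $x,y$ be two distinct variables. The taiga monoid $\mathsf{taig}$ satisfies the non-trivial identity $xyx=yxx$. Furthermore, up to equivalence, this is the unique shortest non-trivial identity satisfied by $\mathsf{taig}$.
   Context: Identities: An identity over an alphabet $X$ of variables is a formal equality $u=v$ with $u,v$ in the free monoid $X^*$; it is non-trivial if $u\neq v$ as words. A monoid $M$ satisfies $u=v$ if $\phi(u)=\phi(v)$ for every monoid homomorphism $\phi:X^*\to M$. A shortest non-trivial identity satisfied by $M$ is a non-trivial identity $u=v$ satisfied by $M$ with $|u|+|v|$ minimal among all non-trivial identities (over any alphabet) satisfied by $M$. Two identities are equivalent if one can be obtained from the other by possibly renaming variables (bijectively) and possibly swapping the two sides. Taiga monoid: Let $\mathcal{A}=\{1<2<3<\cdots\}$ be the natural numbers viewed as an infinite ordered alphabet. A binary search tree with multiplicities is a labelled rooted binary search tree (labels in $\mathcal{A}$) in which each label appears at most once, and where a non-negative integer called the multiplicity is assigned to each node label. Insertion of a symbol $a\in\mathcal{A}$ into such a tree $T$: if $T$ is empty, create a node, label it $a$, and assign it multiplicity $1$. If $T$ is non-empty, let $x$ be the label of the root node; if $a<x$, recursively insert $a$ into the left subtree of the root; if $a>x$, recursively insert $a$ into the right subtree of the root; if $a=x$, increment by $1$ the multiplicity of the label $x$. For $w\in\mathcal{A}^*$, $\mathrm{P}_{\mathsf{taig}}(w)$ is the tree obtained by starting with the empty tree and inserting the symbols of $w$ one by one, proceeding through $w$ from right to left. The relation $u\equiv_{\mathsf{taig}}v\iff \mathrm{P}_{\mathsf{taig}}(u)=\mathrm{P}_{\mathsf{taig}}(v)$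 is a congruence on $\mathcal{A}^*$, and the taiga monoid is $\mathsf{taig}=\mathcal{A}^*/{\equiv_{\mathsf{taig}}}$. *)

(* Defs.v *)
From HB Require Import structures.
From mathcomp Require Import all_boot.

Set Implicit Arguments.
Unset Strict Implicit.
Unset Printing Implicit Defensive.

Import Algebra.
Local Open Scope quotient_scope.

Definition free_monoid (X : Type) : Type := seq X.

HB.instance Definition _ (X : Type) := hasMul.Build (free_monoid X) (@cat X).
HB.instance Definition _ (X : Type) := hasOne.Build (free_monoid X) [::].

(* The structure monoidType of the library includes choiceType. *)
HB.instance Definition _ (X : choiceType) := Choice.copy (free_monoid X) (seq X).
HB.instance Definition _ (X : choiceType) :=
  Magma_isSemigroup.Build (free_monoid X) (@catA X).
HB.instance Definition _ (X : choiceType) :=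
  BaseUMagma_isUMagma.Build (free_monoid X) (@cat0s X) (@cats0 X).

(* [(u, v) : identity X] is the formal equality u = v over the alphabet X. *)
Definition identity (X : Type) : Type := (free_monoid X * free_monoid X)%type.

Definition nontrivial (X : Type) (e : identity X) : Prop := e.1 <> e.2.

Definition satisfies (M : monoidType) (X : Type) (e : identity X) : Prop :=
  forall phi : free_monoid X -> M, monoid_morphism phi -> phi e.1 = phi e.2.

Definition identity_length (X : Type) (e : identity X) : nat :=
  size e.1 + size e.2.

Definition shortest_identity (M : monoidType) (X : Type) (e : identity X)
    : Prop :=
  [/\ nontrivial e, satisfies M e &
      forall (Y : Type) (e' : identity Y), nontrivial e' -> satisfies M e' ->
        identity_length e <= identity_length e'].

Definition swap_sides (X : Type) (e : identity X) : identity X := (e.2, e.1).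

Definition substitute (X Y : Type) (f : X -> Y) (e : identity X) : identity Y :=
  (map f e.1, map f e.2).

(* The renaming is a bijection between the variables occurring in [e] and those
   occurring in [e'], with inverse [g]; the values of [f] and [g] at the other
   letters of the (possibly much larger) alphabets are irrelevant. *)
Definition renaming (X Y : Type) (e : identity X) (e' : identity Y) : Prop :=
  exists (f : X -> Y) (g : Y -> X), substitute f e = e' /\ substitute g e' = e.

Definition equivalent (X Y : Type) (e : identity X) (e' : identity Y) : Prop :=
  renaming e e' \/ renaming (swap_sides e) e'.

Definition letter : Type := {n : nat | 0 < n}.

HB.instance Definition _ := Countable.on letter.

(* Only the trees built by [insert] from [Empty] matter below; these do satisfy
   the search-tree condition. *)
Inductive bstm : Type :=
  | Empty
  | Node of bstm & letter & nat & bstm. (* left, label, multiplicity, right *)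

Fixpoint insert (a : letter) (T : bstm) : bstm :=
  match T with
  | Empty => Node Empty a 1 Empty
  | Node l x m r =>
      if sval a < sval x then Node (insert a l) x m r
      else if sval x < sval a then Node l x m (insert a r)
      else Node l x m.+1 r
  end.

(* [foldr] reads the word from right to left. *)
Definition P_taig (w : free_monoid letter) : bstm := foldr insert Empty w.

Lemma bstm_comparable : comparable bstm.
Proof. by move=> T U; rewrite /decidable; decide equality; exact: eq_comparable. Qed.

HB.instance Definition _ := comparableMixin bstm_comparable.

Definition taig_equiv : rel (free_monoid letter) :=
  fun u v => P_taig u == P_taig v.

Fact taig_equiv_refl : reflexive taig_equiv.
Proof. by move=> u; exact: eqxx. Qed.

Fact taig_equiv_sym : symmetric taig_equiv.
Proof. by move=> u v; exact: eq_sym. Qed.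

Fact taig_equiv_trans : transitive taig_equiv.
Proof. by move=> v u w /eqP uv /eqP vw; apply/eqP; rewrite uv. Qed.

Canonical taig_equiv_rel :=
  EquivRel taig_equiv taig_equiv_refl taig_equiv_sym taig_equiv_trans.

Section Congruence.
Implicit Types (a x y : letter) (w u v : seq letter) (T : bstm).

Fixpoint prune_lt x T :=
  if T is Node l y m r then
    if sval y < sval x then Node l y m (prune_lt x r) else prune_lt x l
  else Empty.

Fixpoint prune_gt x T :=
  if T is Node l y m r then
    if sval x < sval y then Node (prune_gt x l) y m r else prune_gt x r
  else Empty.

Fixpoint mult x T :=
  if T is Node l y m r then
    if sval x < sval y then mult x l else if sval y < sval x then mult x r else m
  else 0.

Lemma prune_lt_insert x a T :
  prune_lt x (insert a T) =
  if sval a < sval x then insert a (prune_lt x T) else prune_lt x T.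
Proof.
elim: T => [|l IHl y m r IHr] /=; first by case: ifP.
case: (ltngtP (sval a) (sval y)) => ay; case: (ltnP (sval y) (sval x)) => yx /=;
  rewrite ?yx ?(leq_gtF yx) ?IHl ?IHr.
- by rewrite (ltn_trans ay yx) /= ay.
- by case: ifP.
- by case: ifP => //= _; rewrite ay ltnNge (ltnW ay).
- by rewrite ltnNge (ltnW (leq_ltn_trans yx ay)).
- by rewrite ay yx /= ltnn.
- by rewrite ay (leq_gtF yx).
Qed.

Lemma prune_gt_insert x a T :
  prune_gt x (insert a T) =
  if sval x < sval a then insert a (prune_gt x T) else prune_gt x T.
Proof.
elim: T => [|l IHl y m r IHr] /=; first by case: ifP.
case: (ltngtP (sval a) (sval y)) => ay; case: (ltnP (sval x) (sval y)) => xy /=;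
  rewrite ?xy ?(leq_gtF xy) ?IHl ?IHr.
- by case: ifP => //= _; rewrite ay.
- by rewrite ltnNge (ltnW (leq_trans ay xy)).
- by rewrite (ltn_trans xy ay) /= ay ltnNge (ltnW ay).
- by case: ifP.
- by rewrite ay xy /= ltnn.
- by rewrite ay (leq_gtF xy).
Qed.

Lemma mult_insert x a T : mult x (insert a T) = (a == x) + mult x T.
Proof.
rewrite -val_eqE /=; elim: T => [|l IHl y m r IHr] /=.
  by rewrite eq_sym; case: (ltngtP (sval x) (sval a)).
case: (ltngtP (sval a) (sval y)) => ay /=.
- rewrite IHl; case: (ltngtP (sval x) (sval y)) => //= xy.
    by rewrite (ltn_eqF (ltn_trans ay xy)).
  by rewrite xy (ltn_eqF ay).
- rewrite IHr; case: (ltngtP (sval x) (sval y)) => //= xy.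
    by rewrite gtn_eqF ?(ltn_trans xy ay).
  by rewrite xy (gtn_eqF ay).
- by rewrite ay; case: (ltngtP (sval x) (sval y)).
Qed.

Lemma P_taig_filter_lt x w :
  P_taig [seq a <- w | sval a < sval x] = prune_lt x (P_taig w).
Proof.
by elim: w => //= a w IH; rewrite prune_lt_insert -IH; case: ifP.
Qed.

Lemma P_taig_filter_gt x w :
  P_taig [seq a <- w | sval x < sval a] = prune_gt x (P_taig w).
Proof.
by elim: w => //= a w IH; rewrite prune_gt_insert -IH; case: ifP.
Qed.

Lemma mult_P_taig x w : mult x (P_taig w) = count_mem x w.
Proof. by elim: w => //= a w IH; rewrite mult_insert IH. Qed.

Lemma foldr_insert_Node w l x m r :
  foldr insert (Node l x m r) w =
  Node (foldr insert l [seq a <- w | sval a < sval x]) x (count_mem x w + m)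
       (foldr insert r [seq a <- w | sval x < sval a]).
Proof.
elim: w => //= a w ->; rewrite -val_eqE /=.
by case: ltngtP => //= ->.
Qed.

Lemma foldr_insert_congr u v T :
  P_taig u = P_taig v -> foldr insert T u = foldr insert T v.
Proof.
elim: T u v => [|l IHl x m r IHr] u v uv; first exact: uv.
rewrite !foldr_insert_Node -!mult_P_taig uv.
congr Node; [apply: IHl | apply: IHr].
  by rewrite !P_taig_filter_lt uv.
by rewrite !P_taig_filter_gt uv.
Qed.

Lemma taig_equiv_cat u u' v v' :
  taig_equiv u u' -> taig_equiv v v' -> taig_equiv (u ++ v) (u' ++ v').
Proof.
move=> /eqP uu' /eqP vv'; apply/eqP; rewrite /P_taig !foldr_cat.
by rewrite (foldr_insert_congr _ uu') -/(P_taig v) vv'.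
Qed.

End Congruence.

Definition taig : Type := {eq_quot taig_equiv_rel}.

HB.instance Definition _ := EqQuotient.on taig.
HB.instance Definition _ := Choice.on taig.

Definition taig_one : taig := \pi_taig [::].

Definition taig_mul (p q : taig) : taig := \pi_taig (repr p ++ repr q).

Lemma taig_mulE (u v : free_monoid letter) :
  taig_mul (\pi_taig u) (\pi_taig v) = \pi_taig (u ++ v).
Proof.
by apply/eqmodP; apply: taig_equiv_cat; apply/eqmodP; rewrite reprK.
Qed.

Fact taig_mulA : associative taig_mul.
Proof.
elim/quotW=> u; elim/quotW=> v; elim/quotW=> w.
by rewrite (taig_mulE v w) (taig_mulE u v) !taig_mulE catA.
Qed.

Fact taig_mul1g : left_id taig_one taig_mul.
Proof. by elim/quotW=> u; rewrite taig_mulE. Qed.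

Fact taig_mulg1 : right_id taig_one taig_mul.
Proof. by elim/quotW=> u; rewrite taig_mulE cats0. Qed.

HB.instance Definition _ := isMonoid.Build taig taig_mulA taig_mul1g taig_mulg1.

(* Main.v *)
Require Import Defs.
From mathcomp Require Import all_boot.
From mathcomp Require Import boolp.

(** Why the theorem holds.

    The identity [xyx = yxx] holds because the shape of a search tree only
    depends on the order in which its labels are first inserted, and a later
    insertion of a label already present only increments a counter, so that it
    commutes with every other insertion ([insert_comm]).  Reading from right to
    left, both [p q p] and [q p p] start by inserting all the letters of the
    word [p]; afterwards the insertions of the second copy of [p] commute with
    those of [q].

    In the other direction, suitable substitutions of words over [{1, 2}] for
    the variables extract two invariants of an identity [u = v] that holds in
    the monoid.  Multiplicities show that every variable occurs equally often in
    [u] and [v] ([satisfies_perm]).  The root of a tree is the last letter of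
    the word, so for any two variables, the same one of them has the rightmost
    occurrence in [u] and in [v] ([satisfies_last_of_pair]); in particular [u]
    and [v] have the same last letter.  After removal of that letter, two
    distinct words that are permutations of each other remain; these have length
    at least 2, and in length 2 they are [pq] and [qp] with [p <> q].  If the
    common last letter were neither [p] nor [q], then the rightmost occurrences
    of [p] and [q] would be in different orders on the two sides.  So it is one
    of them, and the identity is [pqp = qpp] up to a swap of the sides
    ([short_identity]). *)

Set Implicit Arguments.
Unset Strict Implicit.
Unset Printing Implicit Defensive.

(** * The identity holds *)

(** A positive multiplicity of [a] says that the search for [a] ends at an
    existing node, so inserting [a] leaves the shape of the tree alone. *)
Lemma insert_comm (a b : letter) T :
  0 < mult a T -> insert a (insert b T) = insert b (insert a T).
Proof.
elim: T => //= l IHl x m r IHr.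
case: (ltngtP (sval a) (sval x)) => ax; case: (ltngtP (sval b) (sval x)) => bx /=;
  rewrite ?ax ?bx ?ltnn //= ?(leq_gtF (ltnW ax)) ?(leq_gtF (ltnW bx)) //= => pos.
- by rewrite IHl.
- by rewrite IHr.
Qed.

Lemma mult_foldr (a : letter) w T :
  mult a (foldr insert T w) = count_mem a w + mult a T.
Proof. by elim: w => //= b w IHw; rewrite mult_insert IHw addnA. Qed.

Lemma insert_foldr_comm (a : letter) w T :
  0 < mult a T -> insert a (foldr insert T w) = foldr insert (insert a T) w.
Proof.
move=> pos; elim: w => //= b w <-.
by apply: insert_comm; rewrite mult_foldr addn_gt0 pos orbT.
Qed.

Lemma foldr_insert_comm (p q : seq letter) T :
  (forall a, a \in p -> 0 < mult a T) ->
  foldr insert T (p ++ q) = foldr insert T (q ++ p).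
Proof.
rewrite !foldr_cat; elim: p => //= a p IHp pos.
rewrite IHp => [|b bp]; last by apply: pos; rewrite in_cons bp orbT.
apply: insert_foldr_comm.
by rewrite mult_foldr addn_gt0 pos ?orbT ?mem_head.
Qed.

Lemma taig_equiv_pqp (p q : seq letter) : taig_equiv (p ++ q ++ p) (q ++ p ++ p).
Proof.
apply/eqP; rewrite /P_taig !catA !(foldr_cat _ _ (_ ++ _)).
apply: foldr_insert_comm => a ap.
by rewrite mult_foldr addn_gt0 -has_count has_pred1 ap.
Qed.

Lemma taig_satisfies_xyx (X : Type) (x y : X) :
  satisfies taig (([:: x; y; x], [:: y; x; x]) : identity X).
Proof.
move=> phi [_ phiM] /=.
pose g z : free_monoid X := [:: z].
have phi3 a b c : phi [:: a; b; c] =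
    taig_mul (phi (g a)) (taig_mul (phi (g b)) (phi (g c))).
  have -> : [:: a; b; c] = (g a * (g b * g c))%g by [].
  by rewrite !phiM.
rewrite !phi3; elim/quotW: (phi (g x)) => p; elim/quotW: (phi (g y)) => q.
rewrite (taig_mulE q p) (taig_mulE p p) !taig_mulE.
by apply/eqmodP; exact: taig_equiv_pqp.
Qed.

(** * Invariants of the identities that hold *)

(** Every substitution of words for variables extends to a morphism into the
    monoid, so an identity that holds can be tested on trees. *)
Lemma satisfies_P_taig (Y : Type) (e : identity Y) (f : Y -> seq letter) :
  satisfies taig e ->
  P_taig (flatten (map f e.1)) = P_taig (flatten (map f e.2)).
Proof.
move=> sat; apply/eqP; rewrite -/(taig_equiv _ _); apply/eqmodP.
apply: (sat (fun w => \pi_taig (flatten (map f w)))%qT).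
split=> // u v.
by rewrite [RHS]taig_mulE map_cat flatten_cat.
Qed.

Definition one : letter := exist _ 1 isT.
Definition two : letter := exist _ 2 isT.

Lemma satisfies_perm (Y : eqType) (u v : seq Y) :
  satisfies taig ((u, v) : identity Y) -> perm_eq u v.
Proof.
move=> sat; apply/allP => z _; apply/eqP.
(* All the variables but [z] are erased, so the tree of the image of a word
   has a single node, whose multiplicity counts the occurrences of [z]. *)
pose f z' := if z' == z then [:: one] else [::].
have mult_f w : mult one (P_taig (flatten (map f w))) = count_mem z w.
  by rewrite mult_P_taig; elim: w => //= a w IHw; rewrite count_cat IHw /f; case: eqP.
by have /(congr1 (mult one)) := satisfies_P_taig f sat; rewrite !mult_f.
Qed.

(** The root of a tree is the rightmost letter of the word: when all the
    variables but [a] and [b] are erased, it tells which of these two occurs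
    last. *)
Lemma satisfies_last_of_pair (Y : eqType) (a b : Y) (u s v t : seq Y) :
  satisfies taig ((u ++ a :: s, v ++ b :: t) : identity Y) ->
  a \notin s -> b \notin s -> a \notin t -> b \notin t -> a = b.
Proof.
move=> sat as_ bs at_ bt; apply/eqP; apply/negPn/negP => /negPf ab.
pose f z := if z == a then [:: one] else if z == b then [:: two] else [::].
have erased w : a \notin w -> b \notin w -> flatten (map f w) = [::].
  elim: w => //= z w IHw; rewrite !in_cons !negb_or (eq_sym a) (eq_sym b).
  by case/andP=> /negPf za aw /andP[/negPf zb bw]; rewrite IHw // /f za zb.
have fa : f a = [:: one] by rewrite /f eqxx.
have fb : f b = [:: two] by rewrite /f (eq_sym b) ab eqxx.
have := satisfies_P_taig f sat.
rewrite !map_cat !map_cons !flatten_cat /= fa fb (erased s) // (erased t) //.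
by rewrite /P_taig !foldr_cat /= !foldr_insert_Node; case.
Qed.

Lemma satisfies_rcons_last (Y : eqType) (a b : Y) (u v : seq Y) :
  satisfies taig ((rcons u a, rcons v b) : identity Y) -> a = b.
Proof.
rewrite -!cats1 => sat.
exact: (satisfies_last_of_pair sat).
Qed.

(** * Short identities *)

Lemma perm_size2 (Y : eqType) (p q : Y) (w : seq Y) :
  perm_eq [:: p; q] w -> w = [:: p; q] \/ w = [:: q; p].
Proof.
move=> pqw; have := perm_size pqw; case: w pqw => [|r [|s [|]]] // pqw _.
have : r \in [:: p; q] by rewrite (perm_mem pqw) mem_head.
rewrite !inE => /orP[] /eqP er; subst r.
  by move: pqw; rewrite perm_cons => /perm_small_eq -> //; left.
move: pqw; rewrite (perm_catC [:: p] [:: q]) /= perm_cons.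
by move=> /perm_small_eq -> //; right.
Qed.

Lemma short_identity (Y : eqType) (u v : seq Y) :
  satisfies taig ((u, v) : identity Y) -> u <> v -> size u + size v <= 6 ->
  exists p q : Y, p <> q /\
    ((u, v) = ([:: p; q; p], [:: q; p; p]) \/
     (v, u) = ([:: p; q; p], [:: q; p; p])).
Proof.
move=> sat neq; have perm_uv := satisfies_perm sat.
rewrite (perm_size perm_uv) addnn (leq_double _ 3).
case/lastP: u sat neq perm_uv => [|u a] sat neq perm_uv.
  by case: neq; move: perm_uv; rewrite perm_sym => /perm_nilP.
case/lastP: v sat neq perm_uv => [|v b] sat neq perm_uv.
  by have := perm_size perm_uv; rewrite size_rcons.
have eab := satisfies_rcons_last sat; subst b.
move: perm_uv; rewrite -!cats1 perm_cat2r cats1 size_rcons => perm_uv small_v.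
have [v_le1|v_gt1] := leqP (size v) 1.
  by case: neq; rewrite (perm_small_eq v_le1 perm_uv).
have size_v : size v = 2 by apply/eqP; rewrite eqn_leq -ltnS small_v.
have := perm_size perm_uv; rewrite size_v.
case: u perm_uv sat neq => [|p [|q [|]]] // /perm_size2[] -> //= sat neq _.
have pq : p <> q by move=> epq; apply: neq; rewrite epq.
have [eap|/eqP ap] := eqVneq a p.
  by exists p, q; split=> //; left; rewrite eap.
have [eaq|/eqP aq] := eqVneq a q.
  by exists q, p; split; [exact: nesym | right; rewrite eaq].
(* With a third variable at the end, [q] comes after [p] on one side only. *)
case: pq; symmetry.
apply: (@satisfies_last_of_pair Y q p [:: p] [:: a] [:: q] [:: a] sat);
  by rewrite inE eq_sym; apply/eqP.
Qed.

(** Alphabets carry no decidable equality, hence the classical one. *)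
Lemma short_identity_classic (Y : Type) (e : identity Y) :
  nontrivial e -> satisfies taig e -> identity_length e <= 6 ->
  exists p q : Y, p <> q /\
    (e = ([:: p; q; p], [:: q; p; p]) \/
     swap_sides e = ([:: p; q; p], [:: q; p; p])).
Proof.
case: e => u v neq sat; exact: (@short_identity {classic Y} u v sat neq).
Qed.

Lemma renaming_xyx (X Y : Type) (x y : X) (p q : Y) : x <> y -> p <> q ->
  renaming (([:: p; q; p], [:: q; p; p]) : identity Y)
           (([:: x; y; x], [:: y; x; x]) : identity X).
Proof.
have swap (A B : Type) (a b : A) (c d : B) : a <> b ->
    exists f : A -> B, f a = c /\ f b = d.
  move=> ab; exists (fun z => if (z : {classic A}) == a then c else d).
  by rewrite eqxx; case: eqP => // /esym /ab.
move=> xy pq.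
have [f [fp fq]] := swap _ _ p q x y pq.
have [g [gx gy]] := swap _ _ x y p q xy.
by exists f, g; rewrite /substitute /= fp fq gx gy.
Qed.

Theorem proposition3p8 (X : Type) (x y : X) (hxy : x <> y) :
  let xyx_yxx : identity X := ([:: x; y; x], [:: y; x; x]) in
  [/\ nontrivial xyx_yxx,
      satisfies taig xyx_yxx,
      shortest_identity taig xyx_yxx
    & forall (Y : Type) (e : identity Y),
        shortest_identity taig e -> equivalent e xyx_yxx].
Proof.
move=> xyx_yxx.
have nontriv : nontrivial xyx_yxx by case.
have sat : satisfies taig xyx_yxx := taig_satisfies_xyx x y.
split=> //.
  split=> // Y e neq sat_e; rewrite leqNgt; apply/negP => short.
  have [p [q [_ eqs]]] := short_identity_classic neq sat_e (ltnW short).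
  by case: e short eqs {neq sat_e} => u v short [] [eu ev];
    move: short; rewrite eu ev.
move=> Y e [neq sat_e /(_ X xyx_yxx nontriv sat) short].
have [p [q [pq [ee|ee]]]] := short_identity_classic neq sat_e short.
  by left; rewrite ee; exact: renaming_xyx.
by right; rewrite ee; exact: renaming_xyx.
Qed.
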